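(* Let $H_n=\{x\in\mathbb{R}^n: x_1=0\}$ and let $H_n^-=\{x_1\le 0\}$, $H_n^+=\{x_1\ge 0\}$. There exist absolute constants $C,c>0$ such that for every $\eta\in(0,1)$ there is a sequence of centrally symmetric star-shaped bodies $S_n\subseteq\mathbb{R}^n$ (with $S_n=-S_n$) and an integer $N_\eta$ such that for all $n\ge N_\eta$, $\eta(S_n)\ge c\,\eta$ and \[ \mathrm{vol}_{n-1}(H_n\cap S_n)\le C\left(\frac{\eta\ln(1/\eta)}{(1-\eta)\,\mathrm{Diam}(S_n)}\right)\min\{\mathrm{vol}_n(H_n^-\cap S_n),\ \mathrm{vol}_n(H_n^+\cap S_n)\}. \]
   Context: A compact body is a compact set with nonempty interior equal to the closure of its interior. $K_S=\{x\in S: [x,y]\subseteq S\ \forall y\in S\}$ is the kernel of $S$; $S$ is star-shaped if $K_S\ne\emptyset$; a star-shaped body is a compact body that is star-shaped; $\eta(S)=\mathrm{vol}(K_S)/\mathrm{vol}(S)$. $\mathrm{Diam}$ denotes the diameter and $\mathrm{vol}_k$ the $k$-dimensional volume. *)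

(* Defs.v *)
(* classical reals.  Points of R^n are encoded as functions
   nat -> R whose coordinates with index >= n vanish; coordinate x_1 of the
   paper is [x 0].  Sets are predicates. *)
From Stdlib Require Import Reals Lra.
Open Scope R_scope.

Definition pt := nat -> R.
Definition pset := pt -> Prop.

Definition inRn (n : nat) (x : pt) : Prop := forall i, (n <= i)%nat -> x i = 0.
Definition subRn (n : nat) (S : pset) : Prop := forall x, S x -> inRn n x.

Fixpoint sumR (n : nat) (f : nat -> R) : R :=
  match n with O => 0 | S m => sumR m f + f m end.
Fixpoint prodR (n : nat) (f : nat -> R) : R :=
  match n with O => 1 | S m => prodR m f * f m end.

Definition dist (n : nat) (x y : pt) : R :=
  sqrt (sumR n (fun i => (x i - y i) ^ 2)).

Definition ptneg (x : pt) : pt := fun i => - x i.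
Definition comb (t : R) (x y : pt) : pt := fun i => (1 - t) * x i + t * y i.

Definition interior (n : nat) (S : pset) : pset := fun x =>
  inRn n x /\ exists r, 0 < r /\ forall y, inRn n y -> dist n x y < r -> S y.
Definition closure (n : nat) (S : pset) : pset := fun x =>
  inRn n x /\ forall eps, 0 < eps -> exists y, S y /\ dist n x y < eps.
Definition closed (n : nat) (S : pset) : Prop :=
  forall x, closure n S x -> S x.
Definition bounded (n : nat) (S : pset) : Prop :=
  exists M, forall x, S x -> dist n (fun _ => 0) x <= M.
Definition compact (n : nat) (S : pset) : Prop :=
  subRn n S /\ closed n S /\ bounded n S.

Definition compact_body (n : nat) (S : pset) : Prop :=
  compact n S /\ (exists x, interior n S x) /\
  (forall x, S x <-> closure n (interior n S) x).

Definition kernel (S : pset) : pset := fun x =>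
  S x /\ forall y, S y -> forall t, 0 <= t <= 1 -> S (comb t x y).

Definition star_shaped (S : pset) : Prop := exists x, kernel S x.
Definition star_body (n : nat) (S : pset) : Prop :=
  compact_body n S /\ star_shaped S.

Definition centrally_symmetric (S : pset) : Prop :=
  forall x, S x <-> S (ptneg x).

Definition is_glb (E : R -> Prop) (m : R) : Prop :=
  (forall x, E x -> m <= x) /\ (forall m', (forall x, E x -> m' <= x) -> m' <= m).

(* k-dimensional volume := Lebesgue outer measure in R^k
   (inf over countable covers by closed boxes of the sum of box volumes);
   on compact sets it coincides with Lebesgue measure. *)
Definition boxvol (k : nat) (a b : pt) : R :=
  prodR k (fun i => Rmax 0 (b i - a i)).
Definition cover_sums (k : nat) (S : pset) (L : R) : Prop :=
  exists a b : nat -> pt,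
    (forall x, S x -> exists j, forall i, (i < k)%nat -> a j i <= x i <= b j i) /\
    infinite_sum (fun j => boxvol k (a j) (b j)) L.
Definition is_vol (k : nat) (S : pset) (v : R) : Prop :=
  is_glb (cover_sums k S) v.

Definition is_diam (n : nat) (S : pset) (d : R) : Prop :=
  is_lub (fun r => exists x y, S x /\ S y /\ r = dist n x y) d.

(* H_n ∩ S viewed as a subset of R^{n-1} (drop the vanishing first coordinate) *)
Definition shift0 (y : pt) : pt := fun i => match i with O => 0 | S j => y j end.
Definition hslice (n : nat) (S : pset) : pset := fun y =>
  inRn (n - 1) y /\ S (shift0 y).
Definition Hminus (S : pset) : pset := fun x => S x /\ x 0%nat <= 0.
Definition Hplus (S : pset) : pset := fun x => S x /\ 0 <= x 0%nat.

(* Main.v *)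
(* With D = 1 + ln (1/eta), let S be the union of a truncated cone over a cube,
   {-1 <= x_1 <= D, |x_i| <= (1 + (x_1 + 1)/n)/n for i > 1}, and its reflection
   through 0.  Both pieces are convex, so their intersection, which contains
   [-1,1] x [-1/n,1/n]^(n-1), lies in the kernel.  In units of (2/n)^(n-1), the
   section of S at height t has volume about exp(|t| + 1): bounded at t = 0, of
   order 1/eta near |t| = D, and of total mass of order 1/eta.  So the kernel has
   relative volume of order eta, each half has volume of order 1/eta, and the
   diameter is at most 7D, where (1 - eta) D <= 2 ln (1/eta). *)
Require Import Defs.
From Stdlib Require Import Reals ZArith Lra Lia Classical IndefiniteDescription FunctionalExtensionality.
Import Defs.
Open Scope R_scope.

(** * Finite sums and products *)

Lemma sumR_ext (n : nat) (f g : nat -> R) :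
  (forall i, (i < n)%nat -> f i = g i) -> sumR n f = sumR n g.
Proof.
  induction n as [|n IH]; intros H; simpl; [reflexivity|].
  rewrite IH by (intros; apply H; lia). rewrite H by lia. reflexivity.
Qed.

Lemma sumR_le (n : nat) (f g : nat -> R) :
  (forall i, (i < n)%nat -> f i <= g i) -> sumR n f <= sumR n g.
Proof.
  induction n as [|n IH]; intros H; simpl; [lra|].
  assert (sumR n f <= sumR n g) by (apply IH; intros; apply H; lia).
  specialize (H n ltac:(lia)). lra.
Qed.

Lemma sumR_plus (n : nat) (f g : nat -> R) :
  sumR n (fun i => f i + g i) = sumR n f + sumR n g.
Proof. induction n as [|n IH]; simpl; [lra|rewrite IH; lra]. Qed.

Lemma sumR_scal (n : nat) (c : R) (f : nat -> R) :
  sumR n (fun i => c * f i) = c * sumR n f.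
Proof. induction n as [|n IH]; simpl; [lra|rewrite IH; lra]. Qed.

Lemma sumR_nonneg (n : nat) (f : nat -> R) :
  (forall i, (i < n)%nat -> 0 <= f i) -> 0 <= sumR n f.
Proof.
  induction n as [|n IH]; intros H; simpl; [lra|].
  assert (0 <= sumR n f) by (apply IH; intros; apply H; lia).
  specialize (H n ltac:(lia)). lra.
Qed.

Lemma sumR_ge_term (n i : nat) (f : nat -> R) :
  (forall i, (i < n)%nat -> 0 <= f i) -> (i < n)%nat -> f i <= sumR n f.
Proof.
  induction n as [|n IH]; intros H Hi; [lia|]; simpl.
  destruct (Nat.eq_dec i n) as [->|Hne].
  - assert (0 <= sumR n f) by (apply sumR_nonneg; intros; apply H; lia). lra.
  - assert (f i <= sumR n f) by (apply IH; [intros; apply H|]; lia).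
    specialize (H n ltac:(lia)). lra.
Qed.

Lemma sumR_monotone (m n : nat) (f : nat -> R) :
  (forall i, 0 <= f i) -> (m <= n)%nat -> sumR m f <= sumR n f.
Proof.
  intros H; induction 1 as [|n _ IH]; simpl; [lra|specialize (H n); lra].
Qed.

Lemma sumR_S (n : nat) (f : nat -> R) : sumR (S n) f = sum_f_R0 f n.
Proof.
  induction n as [|n IH]; [simpl; lra|].
  change (sumR (S n) f + f (S n) = sum_f_R0 f n + f (S n)). rewrite IH. reflexivity.
Qed.

Lemma sumR_le_infinite_sum (f : nat -> R) (l : R) :
  (forall i, 0 <= f i) -> infinite_sum f l -> forall m, sumR m f <= l.
Proof.
  intros H Hl m. apply Rle_trans with (sumR (S m) f).
  - simpl; specialize (H m); lra.
  - rewrite sumR_S. apply sum_incr; assumption.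
Qed.

Lemma prodR_ext (n : nat) (f g : nat -> R) :
  (forall i, (i < n)%nat -> f i = g i) -> prodR n f = prodR n g.
Proof.
  induction n as [|n IH]; intros H; simpl; [reflexivity|].
  rewrite IH by (intros; apply H; lia). rewrite H by lia. reflexivity.
Qed.

Lemma prodR_nonneg (n : nat) (f : nat -> R) :
  (forall i, (i < n)%nat -> 0 <= f i) -> 0 <= prodR n f.
Proof.
  induction n as [|n IH]; intros H; simpl; [lra|].
  apply Rmult_le_pos; [apply IH; intros|]; apply H; lia.
Qed.

Lemma prodR_le (n : nat) (f g : nat -> R) :
  (forall i, (i < n)%nat -> 0 <= f i <= g i) -> prodR n f <= prodR n g.
Proof.
  induction n as [|n IH]; intros H; simpl; [lra|].
  apply Rmult_le_compat; [|apply H; lia| |apply H; lia].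
  - apply prodR_nonneg; intros; apply H; lia.
  - apply IH; intros; apply H; lia.
Qed.

Lemma prodR_const (n : nat) (w : R) : prodR n (fun _ => w) = w ^ n.
Proof. induction n as [|n IH]; simpl; [reflexivity|rewrite IH; ring]. Qed.

Lemma prodR_recl (n : nat) (f : nat -> R) :
  prodR (S n) f = f 0%nat * prodR n (fun i => f (S i)).
Proof.
  induction n as [|n IH]; [simpl; ring|].
  change (prodR (S n) f * f (S n) = f 0%nat * (prodR n (fun i => f (S i)) * f (S n))).
  rewrite IH; ring.
Qed.

(** Linearity of the product in its [p]-th factor; it makes the volume of a box additive when the
    box is cut across one axis. *)
Lemma prodR_add_one_factor (n p : nat) (f f1 f2 : nat -> R) :
  (p < n)%nat -> f p = f1 p + f2 p ->
  (forall i, i <> p -> f1 i = f i) -> (forall i, i <> p -> f2 i = f i) ->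
  prodR n f = prodR n f1 + prodR n f2.
Proof.
  intros Hp E E1 E2; revert Hp.
  induction n as [|n IH]; intros Hp; simpl; [lia|].
  destruct (Nat.eq_dec p n) as [->|Hne].
  - rewrite (prodR_ext n f1 f) by (intros; apply E1; lia).
    rewrite (prodR_ext n f2 f) by (intros; apply E2; lia). rewrite E; ring.
  - rewrite IH, E1, E2 by lia. ring.
Qed.

(** One-sided continuity of the product. In the inductive step, [(p + e) * (f n + t)] exceeds
    [p * f n] by [p * t] and [e * (f n + t)]; each of the two gets half of [eps], the second one
    through [t <= 1]. *)
Lemma prodR_enlarge (n : nat) (f : nat -> R) (eps : R) :
  (forall i, 0 <= f i) -> 0 < eps ->
  exists th, 0 < th /\ prodR n (fun i => f i + th) <= prodR n f + eps.
Proof.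
  intros Hf; revert eps; induction n as [|n IH]; intros eps He; simpl.
  - exists 1; lra.
  - set (e := eps / (2 * (f n + 1))).
    pose proof (Hf n) as Hn.
    assert (He' : 0 < e) by (unfold e; apply Rdiv_lt_0_compat; lra).
    destruct (IH e He') as [th [Ht Hle]].
    set (p := prodR n f) in *.
    assert (Hp : 0 <= p) by (apply prodR_nonneg; auto).
    exists (Rmin th (Rmin 1 (eps / (2 * (p + 1))))).
    set (t := Rmin th _).
    assert (He2 : 0 < eps / (2 * (p + 1))) by (apply Rdiv_lt_0_compat; lra).
    assert (T : 0 < t /\ t <= th /\ t <= 1 /\ t <= eps / (2 * (p + 1))).
    { unfold t, Rmin; repeat destruct Rle_dec; lra. }
    destruct T as [T0 [T1 [T2 T3]]]. split; [exact T0|].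
    apply Rle_trans with ((p + e) * (f n + t)).
    + apply Rmult_le_compat_r; [lra|].
      apply Rle_trans with (2 := Hle). apply prodR_le; intros i _.
      specialize (Hf i); lra.
    + assert (p * t <= eps / 2).
      { apply Rle_trans with ((p + 1) * (eps / (2 * (p + 1)))).
        - apply Rmult_le_compat; lra.
        - right; field; lra. }
      assert (e * (f n + t) <= eps / 2).
      { apply Rle_trans with (e * (f n + 1)).
        - apply Rmult_le_compat_l; lra.
        - right; unfold e; field; lra. }
      lra.
Qed.

(** * Boxes, and the comparison of their volume with outer measure *)

Definition box (n : nat) (c d : pt) : pset := fun x =>
  inRn n x /\ forall i, (i < n)%nat -> c i <= x i <= d i.

(** The maxima and minima are the corners of the intersection of the boxes [[a, b]] and [[c, d]]; an
    empty intersection has a negative side, which [boxvol] counts as 0. *)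
Definition meetvol (n : nat) (a b c d : pt) : R :=
  boxvol n (fun i => Rmax (a i) (c i)) (fun i => Rmin (b i) (d i)).

Lemma boxvol_nonneg (n : nat) (a b : pt) : 0 <= boxvol n a b.
Proof. apply prodR_nonneg; intros; apply Rmax_l. Qed.

Lemma meetvol_le (n : nat) (a b c d : pt) : meetvol n a b c d <= boxvol n a b.
Proof.
  apply prodR_le; intros i _. split; [apply Rmax_l|].
  unfold Rmax, Rmin; repeat destruct Rle_dec; lra.
Qed.

Definition upd (x : pt) (p : nat) (v : R) : pt :=
  fun i => if Nat.eq_dec i p then v else x i.

Lemma upd_eq (x : pt) (p : nat) (v : R) : upd x p v p = v.
Proof. unfold upd; destruct Nat.eq_dec; congruence. Qed.

Lemma upd_neq (x : pt) (p i : nat) (v : R) : i <> p -> upd x p v i = x i.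
Proof. unfold upd; destruct Nat.eq_dec; congruence. Qed.

Lemma meetvol_split (n p : nat) (a b c d : pt) (m : R) :
  (p < n)%nat -> c p <= m <= d p ->
  meetvol n a b c d = meetvol n a b c (upd d p m) + meetvol n a b (upd c p m) d.
Proof.
  intros Hp Hm. unfold meetvol, boxvol.
  apply prodR_add_one_factor with p; [exact Hp| | |].
  - rewrite !upd_eq. unfold Rmax, Rmin; repeat destruct Rle_dec; lra.
  - intros i Hi; rewrite !upd_neq by exact Hi; reflexivity.
  - intros i Hi; rewrite !upd_neq by exact Hi; reflexivity.
Qed.

Lemma boxvol_split (n p : nat) (c d : pt) (m : R) :
  (p < n)%nat -> c p <= m <= d p ->
  boxvol n c d = boxvol n c (upd d p m) + boxvol n (upd c p m) d.
Proof.
  intros Hp Hm. unfold boxvol.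
  apply prodR_add_one_factor with p; [exact Hp| | |].
  - rewrite !upd_eq. unfold Rmax; repeat destruct Rle_dec; lra.
  - intros i Hi; rewrite !upd_neq by exact Hi; reflexivity.
  - intros i Hi; rewrite !upd_neq by exact Hi; reflexivity.
Qed.

(* The invariant of the bisection in [boxvol_le_cover_sum]. *)
Definition undercovered (n : nat) (a b : nat -> pt) (c d : pt) : Prop :=
  (forall i, (i < n)%nat -> c i <= d i) /\
  exists s, s < boxvol n c d /\
    forall m, sumR m (fun j => meetvol n (a j) (b j) c d) <= s.

(** Volume and covered volume are both additive under the cut, so a deficit of the whole box
    persists in one of its halves. *)
Lemma undercovered_split (n : nat) (a b : nat -> pt) (c d : pt) (p : nat) (m : R) :
  (p < n)%nat -> c p <= m <= d p -> undercovered n a b c d ->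
  undercovered n a b c (upd d p m) \/ undercovered n a b (upd c p m) d.
Proof.
  intros Hp Hm [Hcd [s [Hs Hsum]]].
  rewrite (boxvol_split n p c d m Hp Hm) in Hs.
  set (v1 := boxvol n c (upd d p m)) in *. set (v2 := boxvol n (upd c p m) d) in *.
  (* Half of the deficit: [(v1 - e) + (v2 - e) = s]. If neither half were undercovered, some partial
     sums would exceed [v1 - e] and [v2 - e], and the longer of the two lengths would give a total
     above [s]. *)
  set (e := (v1 + v2 - s) / 2).
  apply NNPP; intros Hno; apply not_or_and in Hno; destruct Hno as [H1 H2].
  assert (K1 : exists k, v1 - e < sumR k (fun j => meetvol n (a j) (b j) c (upd d p m))).
  { apply NNPP; intros Hk; apply H1; split.
    - intros i Hi; unfold upd; destruct Nat.eq_dec; [subst; lra|auto].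
    - exists (v1 - e); split; [fold v1; unfold e; lra|].
      intros k; apply Rnot_lt_le; intros Hlt; apply Hk; exists k; exact Hlt. }
  assert (K2 : exists k, v2 - e < sumR k (fun j => meetvol n (a j) (b j) (upd c p m) d)).
  { apply NNPP; intros Hk; apply H2; split.
    - intros i Hi; unfold upd; destruct Nat.eq_dec; [subst; lra|auto].
    - exists (v2 - e); split; [fold v2; unfold e; lra|].
      intros k; apply Rnot_lt_le; intros Hlt; apply Hk; exists k; exact Hlt. }
  destruct K1 as [k1 K1]; destruct K2 as [k2 K2].
  pose proof (sumR_monotone k1 (Nat.max k1 k2) _
    (fun j => boxvol_nonneg n _ _ : 0 <= meetvol n (a j) (b j) c (upd d p m)) ltac:(lia)).
  pose proof (sumR_monotone k2 (Nat.max k1 k2) _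
    (fun j => boxvol_nonneg n _ _ : 0 <= meetvol n (a j) (b j) (upd c p m) d) ltac:(lia)).
  specialize (Hsum (Nat.max k1 k2)).
  rewrite (sumR_ext _ _ (fun j => meetvol n (a j) (b j) c (upd d p m)
                                + meetvol n (a j) (b j) (upd c p m) d)) in Hsum
    by (intros; apply meetvol_split; assumption).
  rewrite sumR_plus in Hsum. unfold e in *. lra.
Qed.

Lemma undercovered_halve (n : nat) (a b : nat -> pt) (c d : pt) :
  undercovered n a b c d ->
  exists c' d', undercovered n a b c' d' /\
    forall i, (i < n)%nat -> c i <= c' i /\ d' i <= d i /\ d' i - c' i = (d i - c i) / 2.
Proof.
  intros H.
  (* The coordinates are bisected one at a time: the first [p] sides are already halved, the others
     still untouched. *)
  assert (Hp : forall p, (p <= n)%nat -> exists c' d', undercovered n a b c' d' /\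
    (forall i, (i < p)%nat -> c i <= c' i /\ d' i <= d i /\ d' i - c' i = (d i - c i) / 2) /\
    (forall i, (p <= i)%nat -> c' i = c i /\ d' i = d i)).
  { induction p as [|p IH]; intros Hpn.
    - exists c, d; split; [exact H|split; [intros; lia|auto]].
    - destruct IH as [c' [d' [Hu [Hlt Hge]]]]; [lia|].
      destruct (Hge p (le_n p)) as [Ec Ed].
      pose proof (proj1 Hu p ltac:(lia)) as Hcd.
      set (m := (c' p + d' p) / 2).
      assert (Hm : c' p <= m <= d' p) by (unfold m; lra).
      destruct (undercovered_split n a b c' d' p m ltac:(lia) Hm Hu) as [Hu'|Hu'].
      + exists c', (upd d' p m); split; [exact Hu'|split; intros i Hi].
        * destruct (Nat.eq_dec i p) as [->|Hne].
          -- rewrite upd_eq, <- Ec, <- Ed; unfold m; lra.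
          -- rewrite upd_neq by exact Hne; apply Hlt; lia.
        * rewrite upd_neq by lia; apply Hge; lia.
      + exists (upd c' p m), d'; split; [exact Hu'|split; intros i Hi].
        * destruct (Nat.eq_dec i p) as [->|Hne].
          -- rewrite upd_eq, <- Ec, <- Ed; unfold m; lra.
          -- rewrite upd_neq by exact Hne; apply Hlt; lia.
        * rewrite upd_neq by lia; apply Hge; lia. }
  destruct (Hp n (le_n n)) as [c' [d' [Hu [Hlt _]]]].
  exists c', d'; split; assumption.
Qed.

Lemma undercovered_nested (n : nat) (a b : nat -> pt) (c d : pt) :
  undercovered n a b c d ->
  exists cs ds : nat -> pt, cs 0%nat = c /\ ds 0%nat = d /\
    (forall k, undercovered n a b (cs k) (ds k)) /\
    (forall k i, (i < n)%nat -> cs k i <= cs (S k) i /\ ds (S k) i <= ds k i /\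
       ds (S k) i - cs (S k) i = (ds k i - cs k i) / 2).
Proof.
  intros H.
  (* Choice over the subtype of undercovered boxes yields a total step function, which can then be
     iterated. *)
  set (T := {q : pt * pt | undercovered n a b (fst q) (snd q)}).
  assert (Hstep : forall q : T, exists q' : T, forall i, (i < n)%nat ->
    fst (proj1_sig q) i <= fst (proj1_sig q') i /\
    snd (proj1_sig q') i <= snd (proj1_sig q) i /\
    snd (proj1_sig q') i - fst (proj1_sig q') i
      = (snd (proj1_sig q) i - fst (proj1_sig q) i) / 2).
  { intros [[c0 d0] H0]; simpl in *.
    destruct (undercovered_halve n a b c0 d0 H0) as [c' [d' [Hu Hi]]].
    exists (exist _ (c', d') Hu); exact Hi. }
  destruct (functional_choice _ Hstep) as [step Hs].
  set (q := nat_rect (fun _ => T) (exist _ (c, d) H) (fun _ => step)).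
  exists (fun k => fst (proj1_sig (q k))), (fun k => snd (proj1_sig (q k))).
  split; [reflexivity|split; [reflexivity|split]].
  - intros k; exact (proj2_sig (q k)).
  - intros k i Hi; exact (Hs (q k) i Hi).
Qed.

Lemma nested_intervals (u v : nat -> R) :
  (forall k, u k <= v k) -> (forall k, u k <= u (S k)) -> (forall k, v (S k) <= v k) ->
  exists x, forall k, u k <= x <= v k.
Proof.
  intros Huv Hu Hv.
  assert (Mu : forall k m, (k <= m)%nat -> u k <= u m).
  { induction 1 as [|m _ IH]; [lra|specialize (Hu m); lra]. }
  assert (Mv : forall k m, (k <= m)%nat -> v m <= v k).
  { induction 1 as [|m _ IH]; [lra|specialize (Hv m); lra]. }
  assert (Huv2 : forall k m, u k <= v m).
  { intros k m. pose proof (Mu k (Nat.max k m) ltac:(lia)).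
    pose proof (Mv m (Nat.max k m) ltac:(lia)). specialize (Huv (Nat.max k m)). lra. }
  destruct (completeness (fun r => exists k, r = u k)) as [x [Hub Hlub]].
  - exists (v 0%nat); intros r [k ->]; apply Huv2.
  - exists (u 0%nat), 0%nat; reflexivity.
  - exists x; intros k; split; [apply Hub; exists k; reflexivity|].
    apply Hlub; intros r [m ->]; apply Huv2.
Qed.

(** The [j]-th box may gain [eps / 2 ^ (j + 1)] in volume, and these gains sum to at most [eps]. *)
Lemma cover_enlarge (n : nat) (a b : nat -> pt) (l eps : R) :
  0 < eps -> infinite_sum (fun j => boxvol n (a j) (b j)) l ->
  exists th : nat -> R, (forall j, 0 < th j) /\
    forall m, sumR m (fun j => boxvol n (fun i => a j i - th j) (fun i => b j i + th j))
              <= l + eps.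
Proof.
  intros He Hl.
  assert (Hth : forall j, exists t, 0 < t /\
    boxvol n (fun i => a j i - t) (fun i => b j i + t)
      <= boxvol n (a j) (b j) + eps / 2 * (1 / 2) ^ j).
  { intros j.
    destruct (prodR_enlarge n (fun i => Rmax 0 (b j i - a j i)) (eps / 2 * (1 / 2) ^ j))
      as [t [Ht Hle]].
    - intros; apply Rmax_l.
    - apply Rmult_lt_0_compat; [lra|apply pow_lt; lra].
    (* A margin of [t / 2] at both ends lengthens each side by at most [t]. *)
    - exists (t / 2); split; [lra|].
      apply Rle_trans with (2 := Hle). apply prodR_le; intros i _.
      split; [apply Rmax_l|]. unfold Rmax; repeat destruct Rle_dec; lra. }
  destruct (functional_choice _ Hth) as [th H].
  exists th; split; [intros j; apply H|]. intros m.
  apply Rle_trans with (sumR m (fun j => boxvol n (a j) (b j) + eps / 2 * (1 / 2) ^ j)).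
  - apply sumR_le; intros j _; apply H.
  - rewrite sumR_plus, sumR_scal.
    pose proof (sumR_le_infinite_sum _ l (fun j => boxvol_nonneg n (a j) (b j)) Hl m).
    assert (G : sumR m (fun j => (1 / 2) ^ j) <= 2 - 2 * (1 / 2) ^ m).
    { clear; induction m as [|m IH]; simpl; lra. }
    assert (0 < (1 / 2) ^ m) by (apply pow_lt; lra).
    assert (eps / 2 * sumR m (fun j => (1 / 2) ^ j) <= eps / 2 * 2)
      by (apply Rmult_le_compat_l; lra).
    change (sumR m (pow (1 / 2))) with (sumR m (fun j => (1 / 2) ^ j)). lra.
Qed.

Lemma finite_bound (n : nat) (w : nat -> R) :
  exists W, 0 < W /\ forall i, (i < n)%nat -> w i <= W.
Proof.
  induction n as [|n [W [HW H]]]; [exists 1; split; [lra|intros; lia]|].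
  exists (Rmax W (w n)); split.
  - apply Rlt_le_trans with W; [exact HW|apply Rmax_l].
  - intros i Hi; destruct (Nat.eq_dec i n) as [->|]; [apply Rmax_r|].
    apply Rle_trans with W; [apply H; lia|apply Rmax_l].
Qed.

(* If the boxes of a cover had total volume smaller than that of the box [c, d],
   so would slight enlargements of them; bisecting [c, d] while keeping that
   strict inequality leads to a point around which some enlarged box contains
   all small boxes, which contradicts the inequality there. *)
Lemma boxvol_le_cover_sum (n : nat) (S : pset) (c d : pt) (l : R) :
  (forall i, (i < n)%nat -> c i <= d i) -> (forall x, box n c d x -> S x) ->
  cover_sums n S l -> boxvol n c d <= l.
Proof.
  intros Hcd HS [a [b [Hcov Hl]]]. apply Rnot_lt_le; intros Hlt.
  set (eps := (boxvol n c d - l) / 2).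
  destruct (cover_enlarge n a b l eps) as [th [Hth Hsum]]; [unfold eps; lra|exact Hl|].
  set (a' := fun j i => a j i - th j). set (b' := fun j i => b j i + th j).
  assert (Hu : undercovered n a' b' c d).
  { split; [exact Hcd|]. exists (l + eps); split; [unfold eps; lra|].
    intros m. apply Rle_trans with (2 := Hsum m).
    apply sumR_le; intros j _; apply meetvol_le. }
  destruct (undercovered_nested n a' b' c d Hu) as [cs [ds [Ec [Ed [Hus Hstep]]]]].
  assert (Hx : forall i, exists xi, ((i < n)%nat -> forall k, cs k i <= xi <= ds k i) /\
                                    ((n <= i)%nat -> xi = 0)).
  { intros i; destruct (Nat.lt_ge_cases i n) as [Hi|Hi].
    - destruct (nested_intervals (fun k => cs k i) (fun k => ds k i)) as [xi H].
      + intros k; apply (proj1 (Hus k)); exact Hi.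
      + intros k; apply Hstep; exact Hi.
      + intros k; apply Hstep; exact Hi.
      + exists xi; split; [intros _; exact H|lia].
    - exists 0; split; [lia|auto]. }
  destruct (functional_choice _ Hx) as [x Hxs].
  destruct (Hcov x) as [j Hj].
  { apply HS; split; [intros i Hi; apply Hxs; exact Hi|].
    intros i Hi; rewrite <- Ec, <- Ed; apply Hxs; exact Hi. }
  assert (Hw : forall k i, (i < n)%nat -> ds k i - cs k i = (d i - c i) * (1 / 2) ^ k).
  { intros k i Hi; induction k as [|k IH]; simpl; [rewrite Ec, Ed; ring|].
    destruct (Hstep k i Hi) as [_ [_ E]]. rewrite E, IH; field. }
  (* After [k] bisections every side is at most [W * (1 / 2) ^ k]; [k] is taken so large that this
     is at most the margin [th j] of the box containing [x]. *)
  destruct (finite_bound n (fun i => d i - c i)) as [W [HW HWi]].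
  destruct (pow_lt_1_zero (1 / 2)) with (y := th j / W) as [k Hk].
  { rewrite Rabs_pos_eq; lra. }
  { apply Rdiv_lt_0_compat; [apply Hth|exact HW]. }
  specialize (Hk k (le_n k)). rewrite Rabs_pos_eq in Hk by (apply pow_le; lra).
  assert (Hth' : W * (1 / 2) ^ k <= th j).
  { apply Rle_trans with (W * (th j / W)); [apply Rmult_le_compat_l; lra|].
    right; field; lra. }
  destruct (Hus k) as [Hck [s [Hs Hm]]]. specialize (Hm (Datatypes.S j)).
  pose proof (sumR_ge_term (Datatypes.S j) j
    (fun j => meetvol n (a' j) (b' j) (cs k) (ds k))
    (fun i _ => boxvol_nonneg n _ _) ltac:(lia)) as Hterm. cbv beta in Hterm.
  (* The small box contains [x] and has sides at most [th j], so it lies inside the [j]-th enlarged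
     box. That single term then reaches the full volume, against [s < boxvol n (cs k) (ds k)]. *)
  assert (E : meetvol n (a' j) (b' j) (cs k) (ds k) = boxvol n (cs k) (ds k)).
  { apply prodR_ext; intros i Hi. f_equal.
    specialize (Hj i Hi). pose proof (proj1 (Hxs i) Hi k). specialize (Hw k i Hi).
    assert ((d i - c i) * (1 / 2) ^ k <= W * (1 / 2) ^ k).
    { apply Rmult_le_compat_r; [apply pow_le; lra|apply HWi; exact Hi]. }
    unfold a', b'. rewrite Rmin_right, Rmax_right by lra. reflexivity. }
  lra.
Qed.

Lemma boxvol_le_vol (n : nat) (S : pset) (c d : pt) (v : R) :
  (forall i, (i < n)%nat -> c i <= d i) -> (forall x, box n c d x -> S x) ->
  is_vol n S v -> boxvol n c d <= v.
Proof.
  intros Hcd HS [_ Hglb]. apply Hglb; intros l Hl.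
  exact (boxvol_le_cover_sum n S c d l Hcd HS Hl).
Qed.

Lemma vol_le_boxvol (k : nat) (S : pset) (c d : pt) (v : R) :
  (1 <= k)%nat -> (forall x, S x -> forall i, (i < k)%nat -> c i <= x i <= d i) ->
  is_vol k S v -> v <= boxvol k c d.
Proof.
  intros Hk HS [Hlb _]. apply Hlb.
  (* All boxes after the first have lower corner 1 and upper corner 0. Their volume is 0 because
     [1 <= k]; in dimension 0 the empty product would be 1. *)
  exists (fun j => match j with O => c | _ => fun _ => 1 end),
         (fun j => match j with O => d | _ => fun _ => 0 end).
  split; [intros x Hx; exists 0%nat; exact (HS x Hx)|].
  intros eps He; exists 0%nat; intros m _.
  replace (sum_f_R0 _ m) with (boxvol k c d); [rewrite R_dist_eq; exact He|].
  induction m as [|m IH]; [reflexivity|]. simpl. rewrite <- IH.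
  destruct k as [|k]; [lia|]. unfold boxvol at 3; simpl.
  rewrite (Rmax_left 0 (0 - 1)) by lra. ring.
Qed.

Lemma boxvol_first (m : nat) (a b : pt) (w0 w : R) :
  0 <= w0 -> 0 <= w -> b 0%nat - a 0%nat = w0 ->
  (forall i, b (S i) - a (S i) = w) -> boxvol (S m) a b = w0 * w ^ m.
Proof.
  intros H0 H E0 E. unfold boxvol. rewrite prodR_recl, E0, Rmax_right by exact H0.
  rewrite (prodR_ext m _ (fun _ => w)), prodR_const; [reflexivity|].
  intros i _; rewrite E; apply Rmax_right; exact H.
Qed.

Lemma sumR_le_first (m : nat) (f : nat -> R) (u v : R) :
  f 0%nat <= u -> (forall i, (1 <= i <= m)%nat -> f i <= v) ->
  sumR (S m) f <= u + INR m * v.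
Proof.
  intros Hu Hv; induction m as [|m IH]; [simpl; lra|].
  change (sumR (S m) f + f (S m) <= u + INR (S m) * v). rewrite S_INR.
  assert (sumR (S m) f <= u + INR m * v) by (apply IH; intros; apply Hv; lia).
  specialize (Hv (S m) ltac:(lia)). lra.
Qed.

(** * Euclidean distance, and star bodies whose kernel contains a ball *)

Lemma dist_coord (n i : nat) (x y : pt) :
  (i < n)%nat -> Rabs (x i - y i) <= dist n x y.
Proof.
  intros Hi. unfold dist. rewrite <- sqrt_Rsqr_abs. apply sqrt_le_1_alt.
  unfold Rsqr. replace ((x i - y i) * (x i - y i)) with ((x i - y i) ^ 2) by ring.
  apply (sumR_ge_term n i (fun i => (x i - y i) ^ 2)); [intros; apply pow2_ge_0|exact Hi].
Qed.

Lemma dist_scal (n : nat) (k : R) (u v p q : pt) :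
  (forall i, (i < n)%nat -> u i - v i = k * (p i - q i)) ->
  dist n u v = Rabs k * dist n p q.
Proof.
  intros H. unfold dist. rewrite <- sqrt_Rsqr_abs, <- sqrt_mult_alt by apply Rle_0_sqr.
  f_equal. rewrite <- sumR_scal. apply sumR_ext; intros i Hi. rewrite H by exact Hi.
  unfold Rsqr; ring.
Qed.

Lemma dist_refl (n : nat) (x : pt) : dist n x x = 0.
Proof.
  rewrite (dist_scal n 0 x x x x) by (intros; ring). rewrite Rabs_R0; ring.
Qed.

Lemma interior_sub (n : nat) (S : pset) (x : pt) : interior n S x -> S x.
Proof. intros [Hx [r [Hr H]]]. apply H; [exact Hx|rewrite dist_refl; exact Hr]. Qed.

(** A point [y] within [(1 - s) * r] of [s * x] lies on the segment from [w = (y - s * x) / (1 - s)]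
    to [x], and [w] is within [r] of the origin, hence in the kernel. *)
Lemma interior_of_kernel_ball (n : nat) (S : pset) (r s : R) (x : pt) :
  0 < r -> subRn n S ->
  (forall y, inRn n y -> dist n (fun _ => 0) y < r -> kernel S y) ->
  S x -> 0 <= s < 1 -> interior n S (fun i => s * x i).
Proof.
  intros Hr Hsub Hball Hx Hs. split; [intros i Hi; rewrite (Hsub x Hx i Hi); ring|].
  exists ((1 - s) * r); split; [apply Rmult_lt_0_compat; lra|]. intros y Hy Hd.
  set (w := fun i => (y i - s * x i) / (1 - s)).
  replace y with (comb s w x).
  - apply Hball; [| |exact Hx|lra].
    + intros i Hi; unfold w; rewrite (Hy i Hi), (Hsub x Hx i Hi); field; lra.
    + rewrite (dist_scal n (1 - s) _ _ (fun _ => 0) w) in Hd.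
      * rewrite Rabs_pos_eq in Hd by lra. apply Rmult_lt_reg_l with (1 - s); lra.
      * intros i _; unfold w; field; lra.
  - apply functional_extensionality; intros i; unfold comb, w; field; lra.
Qed.

(** Every [x] in [S] is the limit of the interior points [(1 - t) * x] as [t] tends to 0, so [S] is
    the closure of its interior. *)
Lemma star_body_of_kernel_ball (n : nat) (S : pset) (r : R) :
  0 < r -> compact n S ->
  (forall y, inRn n y -> dist n (fun _ => 0) y < r -> kernel S y) -> star_body n S.
Proof.
  intros Hr HS Hball. pose proof HS as [Hsub [Hcl _]].
  assert (H0 : kernel S (fun _ => 0)).
  { apply Hball; [intros i _; reflexivity|rewrite dist_refl; exact Hr]. }
  split; [|exists (fun _ => 0); exact H0].
  split; [exact HS|split].
  - exists (fun _ => 0); split; [intros i _; reflexivity|]. exists r; split; [exact Hr|].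
    intros y Hy Hd; exact (proj1 (Hball y Hy Hd)).
  - intros x; split.
    + intros Hx; split; [exact (Hsub x Hx)|]. intros eps He.
      set (D := dist n (fun _ => 0) x).
      assert (HD : 0 <= D) by apply sqrt_pos.
      set (t := Rmin (1 / 2) (eps / (2 * (D + 1)))).
      assert (He' : 0 < eps / (2 * (D + 1))) by (apply Rdiv_lt_0_compat; lra).
      assert (Ht : 0 < t <= 1 / 2 /\ t <= eps / (2 * (D + 1))).
      { unfold t, Rmin; destruct Rle_dec; lra. }
      exists (fun i => (1 - t) * x i); split.
      * apply interior_of_kernel_ball with r; auto; lra.
      * rewrite (dist_scal n (- t) _ _ (fun _ => 0) x) by (intros; ring).
        fold D. rewrite Rabs_Ropp, Rabs_pos_eq by lra.
        apply Rle_lt_trans with (eps / (2 * (D + 1)) * (D + 1)).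
        -- apply Rmult_le_compat; lra.
        -- replace (_ * _) with (eps / 2) by (field; lra). lra.
    + intros [Hx Hc]. apply Hcl; split; [exact Hx|]. intros eps He.
      destruct (Hc eps He) as [y [Hy Hd]]. exists y; split; [|exact Hd].
      exact (interior_sub n S y Hy).
Qed.

(** * Geometry of the double frustum: convexity, kernel, symmetry, diameter bound, compactness *)

(* The cone over a cube, with axis along the first coordinate and apex far away,
   truncated to [-1 <= s * x_1 <= D]; [s = 1] or [s = -1] gives its direction. *)
Definition frustum (n : nat) (D s : R) : pset := fun x =>
  -1 <= s * x 0%nat <= D /\
  forall i, (1 <= i < n)%nat ->
    Rabs (x i) <= / INR n * (1 + (s * x 0%nat + 1) / INR n).

Definition bowtie (n : nat) (D : R) : pset := fun x =>
  inRn n x /\ (frustum n D 1 x \/ frustum n D (-1) x).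

Lemma INR_ge_1 (n : nat) : (1 <= n)%nat -> 1 <= INR n.
Proof. intros H; apply (le_INR 1); exact H. Qed.

Lemma inv_INR_bounds (n : nat) : (1 <= n)%nat -> 0 < / INR n <= 1.
Proof.
  intros Hn; pose proof (INR_ge_1 n Hn). split; [apply Rinv_0_lt_compat; lra|].
  rewrite <- Rinv_1. apply Rinv_le_contravar; lra.
Qed.

(** The bound on [Rabs (x i)] is affine in [x 0], so the triangle inequality preserves it. *)
Lemma frustum_convex (n : nat) (D s t : R) (x y : pt) :
  0 <= t <= 1 -> frustum n D s x -> frustum n D s y -> frustum n D s (comb t x y).
Proof.
  intros Ht [Hx Hxi] [Hy Hyi]; split.
  - unfold comb.
    replace (s * _) with ((1 - t) * (s * x 0%nat) + t * (s * y 0%nat)) by ring. nra.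
  - intros i Hi. specialize (Hxi i Hi); specialize (Hyi i Hi). unfold comb.
    apply Rle_trans with ((1 - t) * Rabs (x i) + t * Rabs (y i)).
    + eapply Rle_trans; [apply Rabs_triang|]. rewrite !Rabs_mult.
      rewrite (Rabs_pos_eq (1 - t)), (Rabs_pos_eq t) by lra. lra.
    + apply (Rmult_le_compat_l (1 - t)) in Hxi; [|lra].
      apply (Rmult_le_compat_l t) in Hyi; [|lra].
      unfold Rdiv in *. set (k := / INR n) in *. lra.
Qed.

Lemma kernel_bowtie (n : nat) (D : R) (x : pt) :
  inRn n x -> frustum n D 1 x -> frustum n D (-1) x -> kernel (bowtie n D) x.
Proof.
  intros Hx H1 H2; split; [split; auto|].
  intros y [Hy Hf] t Ht. split.
  - intros i Hi; unfold comb; rewrite (Hx i Hi), (Hy i Hi); ring.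
  - destruct Hf; [left|right]; apply frustum_convex; assumption.
Qed.

Lemma frustum_ptneg (n : nat) (D s : R) (x : pt) :
  frustum n D s x -> frustum n D (- s) (ptneg x).
Proof.
  intros [H0 H]. unfold frustum, ptneg.
  replace (- s * - x 0%nat) with (s * x 0%nat) by ring.
  split; [exact H0|]. intros i Hi; rewrite Rabs_Ropp; auto.
Qed.

Lemma bowtie_symmetric (n : nat) (D : R) : centrally_symmetric (bowtie n D).
Proof.
  assert (H : forall x, bowtie n D x -> bowtie n D (ptneg x)).
  { intros x [Hx Hf]; split; [intros i Hi; unfold ptneg; rewrite (Hx i Hi); ring|].
    destruct Hf as [Hf|Hf]; apply frustum_ptneg in Hf; [right; exact Hf|left].
    replace 1 with (- -1) by ring; exact Hf. }
  intros x; split; [apply H|]. intros Hn; apply H in Hn.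
  replace x with (ptneg (ptneg x)); [exact Hn|].
  apply functional_extensionality; intros i; unfold ptneg; ring.
Qed.

Lemma frustum_core (n : nat) (D s : R) (x : pt) :
  (1 <= n)%nat -> 1 <= D -> -1 <= s * x 0%nat <= 1 ->
  (forall i, (1 <= i < n)%nat -> Rabs (x i) <= / INR n) -> frustum n D s x.
Proof.
  intros Hn HD H0 H; split; [lra|]. intros i Hi.
  pose proof (INR_ge_1 n Hn). apply Rle_trans with (1 := H i Hi).
  assert (0 < / INR n) by (apply Rinv_0_lt_compat; lra).
  assert (0 <= (s * x 0%nat + 1) / INR n).
  { apply Rmult_le_pos; lra. }
  rewrite <- (Rmult_1_r (/ INR n)) at 1. apply Rmult_le_compat_l; lra.
Qed.

Lemma kernel_bowtie_core (n : nat) (D : R) (x : pt) :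
  (1 <= n)%nat -> 1 <= D -> inRn n x -> -1 <= x 0%nat <= 1 ->
  (forall i, (1 <= i < n)%nat -> Rabs (x i) <= / INR n) -> kernel (bowtie n D) x.
Proof.
  intros Hn HD Hx H0 H. apply kernel_bowtie; [exact Hx| |];
    apply frustum_core; auto; lra.
Qed.

(** The half-width increases with [s * x 0], which is at most [Rabs (x 0)] for either sign [s], so
    one bound serves both pieces. *)
Lemma bowtie_coords (n : nat) (D : R) (x : pt) :
  1 <= D -> bowtie n D x ->
  Rabs (x 0%nat) <= D /\
  forall i, (1 <= i < n)%nat ->
    Rabs (x i) <= / INR n * (1 + (Rabs (x 0%nat) + 1) / INR n).
Proof.
  intros HD [_ Hf]. split.
  - destruct Hf as [[H0 _]|[H0 _]]; apply Rabs_le; lra.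
  - assert (K : exists s, s * x 0%nat <= Rabs (x 0%nat) /\ frustum n D s x).
    { destruct Hf as [Hf|Hf]; [exists 1|exists (-1)]; (split; [|exact Hf]).
      - rewrite Rmult_1_l; apply Rle_abs.
      - rewrite <- Rabs_Ropp. replace (-1 * x 0%nat) with (- x 0%nat) by ring.
        apply Rle_abs. }
    destruct K as [s [Hs [_ H]]]. intros i Hi. apply Rle_trans with (1 := H i Hi).
    assert (0 < / INR n) by (apply Rinv_0_lt_compat, lt_0_INR; lia).
    apply Rmult_le_compat_l; [lra|]. apply Rplus_le_compat_l.
    apply Rmult_le_compat_r; lra.
Qed.

Lemma bowtie_dist_le (n : nat) (D : R) (x y : pt) :
  (1 <= n)%nat -> 1 <= D -> bowtie n D x -> bowtie n D y -> dist n x y <= 7 * D.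
Proof.
  intros Hn HD Hx Hy. pose proof (INR_ge_1 n Hn) as HN.
  pose proof (inv_INR_bounds n Hn) as HI.
  assert (HII : INR n * / INR n = 1) by (field; lra).
  assert (B : forall z, bowtie n D z -> forall i, (1 <= i < n)%nat ->
            Rabs (z i) <= / INR n * (3 * D)).
  { intros z Hz i Hi. destruct (bowtie_coords n D z HD Hz) as [H0 H].
    apply Rle_trans with (1 := H i Hi). apply Rmult_le_compat_l; [lra|].
    unfold Rdiv. pose proof (Rabs_pos (z 0%nat)).
    assert ((Rabs (z 0%nat) + 1) * / INR n <= (Rabs (z 0%nat) + 1) * 1)
      by (apply Rmult_le_compat_l; lra). lra. }
  destruct (bowtie_coords n D x HD Hx) as [Hx0 _].
  destruct (bowtie_coords n D y HD Hy) as [Hy0 _].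
  unfold dist. rewrite <- (sqrt_pow2 (7 * D)) by lra. apply sqrt_le_1_alt.
  destruct n as [|m]; [lia|].
  set (k := / INR (S m)) in *.
  (* The first coordinates differ by at most [2 * D], each of the [m] others by at most [6 * D * k].
     As [k <= 1] and [INR m * k <= 1], the total is at most [40 * D ^ 2], below [(7 * D) ^ 2]. *)
  apply Rle_trans with (4 * D ^ 2 + INR m * (k * (36 * D ^ 2))).
  - apply sumR_le_first.
    + assert (-D <= x 0%nat <= D) by (revert Hx0; unfold Rabs; destruct Rcase_abs; lra).
      assert (-D <= y 0%nat <= D) by (revert Hy0; unfold Rabs; destruct Rcase_abs; lra).
      nra.
    + intros i Hi.
      pose proof (B x Hx i ltac:(lia)) as Bx. pose proof (B y Hy i ltac:(lia)) as By.
      assert (-(k * (3 * D)) <= x i <= k * (3 * D))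
        by (revert Bx; unfold Rabs; destruct Rcase_abs; lra).
      assert (-(k * (3 * D)) <= y i <= k * (3 * D))
        by (revert By; unfold Rabs; destruct Rcase_abs; lra).
      apply Rle_trans with ((k * (6 * D)) ^ 2); [nra|].
      replace ((k * (6 * D)) ^ 2) with (k * (36 * D ^ 2) * k) by ring.
      rewrite <- (Rmult_1_r (k * (36 * D ^ 2))) at 2.
      apply Rmult_le_compat_l; [|lra].
      apply Rmult_le_pos; [lra|nra].
  - assert (INR m * k <= 1).
    { rewrite S_INR in HII. lra. }
    nra.
Qed.

Lemma frustum_closed (n : nat) (D s : R) (x : pt) :
  (1 <= n)%nat -> Rabs s = 1 ->
  (forall eps, 0 < eps -> exists y, frustum n D s y /\ dist n x y < eps) ->
  frustum n D s x.
Proof.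
  intros Hn Hs H. pose proof (INR_ge_1 n Hn).
  pose proof (inv_INR_bounds n Hn) as HI.
  assert (C : forall y eps i, (i < n)%nat -> dist n x y < eps ->
            - eps < x i - y i < eps).
  { intros y eps i Hi Hd.
    pose proof (Rle_lt_trans _ _ _ (dist_coord n i x y Hi) Hd) as K.
    apply Rabs_def2 in K; lra. }
  assert (C0 : forall y eps, dist n x y < eps ->
            - eps < s * x 0%nat - s * y 0%nat < eps).
  { intros y eps Hd. pose proof (C y eps 0%nat ltac:(lia) Hd).
    revert Hs; unfold Rabs; destruct Rcase_abs; intros Hs.
    - replace s with (-1) by lra. lra.
    - replace s with 1 by lra. lra. }
  repeat split.
  - apply le_epsilon; intros eps He. destruct (H eps He) as [y [[Hy _] Hd]].
    specialize (C0 y eps Hd); lra.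
  - apply le_epsilon; intros eps He. destruct (H eps He) as [y [[Hy _] Hd]].
    specialize (C0 y eps Hd); lra.
  - intros i Hi. apply le_epsilon; intros eps He.
    (* Half of [eps] pays for replacing [y i] by [x i], the other half for the change of the width
       bound, whose slope [k * k] is at most 1. *)
    destruct (H (eps / 2) ltac:(lra)) as [y [[_ Hy] Hd]].
    specialize (C0 y _ Hd). specialize (C y _ i ltac:(lia) Hd). specialize (Hy i Hi).
    apply Rle_trans with (Rabs (y i) + eps / 2).
    { revert Hy; unfold Rabs; repeat destruct Rcase_abs; lra. }
    set (k := / INR n) in *. unfold Rdiv in *. fold k in Hy |- *.
    assert (k * k <= 1) by nra. assert (0 <= k * k) by nra.
    assert (k * k * (s * y 0%nat - s * x 0%nat) <= eps * / 2) by nra.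
    lra.
Qed.

Lemma bowtie_closed (n : nat) (D : R) : (1 <= n)%nat -> Defs.closed n (bowtie n D).
Proof.
  intros Hn x [Hx H]. split; [exact Hx|].
  apply NNPP; intros Hno; apply not_or_and in Hno; destruct Hno as [H1 H2].
  assert (K : forall s, Rabs s = 1 -> ~ frustum n D s x ->
    exists eps, 0 < eps /\ forall y, dist n x y < eps -> ~ frustum n D s y).
  { intros s Hs Hf. apply NNPP; intros Hk. apply Hf, frustum_closed; [exact Hn|exact Hs|].
    intros eps He. apply NNPP; intros Hy. apply Hk; exists eps; split; [exact He|].
    intros y Hd Hfy. apply Hy; exists y; split; assumption. }
  destruct (K 1) as [e1 [He1 K1]]; [apply Rabs_R1|exact H1|].
  destruct (K (-1)) as [e2 [He2 K2]]; [rewrite Rabs_left; lra|exact H2|].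
  destruct (H (Rmin e1 e2)) as [y [[_ Hy] Hd]]; [apply Rmin_glb_lt; assumption|].
  pose proof (Rmin_l e1 e2); pose proof (Rmin_r e1 e2).
  destruct Hy as [Hy|Hy]; [apply (K1 y)|apply (K2 y)]; auto; lra.
Qed.

(** The ball of radius [/ INR n] about the origin lies in the central box, and so in the kernel. *)
Lemma bowtie_star_body (n : nat) (D : R) :
  (1 <= n)%nat -> 1 <= D -> star_body n (bowtie n D).
Proof.
  intros Hn HD. pose proof (INR_ge_1 n Hn).
  pose proof (inv_INR_bounds n Hn) as HI.
  assert (Hball : forall y, inRn n y -> dist n (fun _ => 0) y < / INR n ->
                  kernel (bowtie n D) y).
  { intros y Hy Hd.
    assert (C : forall i, (i < n)%nat -> Rabs (y i) <= / INR n).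
    { intros i Hi. pose proof (dist_coord n i (fun _ => 0) y Hi) as K. simpl in K.
      rewrite Rminus_0_l, Rabs_Ropp in K. lra. }
    apply kernel_bowtie_core; auto.
    - specialize (C 0%nat ltac:(lia)). revert C; unfold Rabs; destruct Rcase_abs; lra.
    - intros i Hi; apply C; lia. }
  apply star_body_of_kernel_ball with (/ INR n); [lra| |exact Hball].
  split; [intros x Hx; exact (proj1 Hx)|split; [apply bowtie_closed; exact Hn|]].
  exists (7 * D). intros x Hx. apply bowtie_dist_le; auto.
  apply Hball; [intros i _; reflexivity|rewrite dist_refl; lra].
Qed.

(** * Geometric series and exponential estimates *)

Lemma infinite_sum_geometric (g r : R) :
  0 <= r < 1 -> infinite_sum (fun j => g * r ^ j) (g / (1 - r)).
Proof.
  intros Hr.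
  assert (H : Un_cv (fun N => g * sum_f_R0 (fun j => 1 * r ^ j) N) (g * / (1 - r))).
  { apply CV_mult; [intros eps He; exists 0%nat; intros; rewrite R_dist_eq; exact He|].
    apply GP_infinite. rewrite Rabs_pos_eq; lra. }
  intros eps He. destruct (H eps He) as [N HN]. exists N; intros m Hm.
  specialize (HN m Hm). rewrite scal_sum in HN.
  rewrite (sum_eq _ (fun j => g * r ^ j)) in HN; [exact HN|intros; ring].
Qed.

Lemma exp_mult_INR (m : nat) (x : R) : exp x ^ m = exp (INR m * x).
Proof.
  induction m as [|m IH]; [rewrite Rmult_0_l, exp_0; reflexivity|].
  rewrite S_INR. simpl. rewrite IH, <- exp_plus. f_equal; ring.
Qed.

(** At [- (u / (1 + u))] the inequality [1 + t <= exp t] has left side [/ (1 + u)]; inverting it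
    gives the claim. *)
Lemma exp_quotient_le (u : R) : 0 <= u -> exp (u / (1 + u)) <= 1 + u.
Proof.
  intros Hu. pose proof (exp_ineq1_le (- (u / (1 + u)))) as H.
  rewrite exp_Ropp in H. replace (1 + - (u / (1 + u))) with (/ (1 + u)) in H by (field; lra).
  apply Rinv_le_contravar in H; [|apply Rinv_0_lt_compat; lra].
  rewrite !Rinv_inv in H. exact H.
Qed.

(** With [N = INR (S m)], the power is at least [exp ((N - 1) * D / (N + D))], whose exponent
    exceeds [D - 1] by [(N - D ^ 2) / (N + D)]. This is where the dimension must be large compared
    with [D]. *)
Lemma exp_le_pow (m : nat) (D : R) :
  0 <= D -> D ^ 2 <= INR (S m) -> exp (D - 1) <= (1 + D / INR (S m)) ^ m.
Proof.
  intros HD Hm. pose proof (lt_0_INR (S m) ltac:(lia)) as HN.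
  set (u := D / INR (S m)).
  assert (Hu : 0 <= u) by (apply Rmult_le_pos; [exact HD|left; apply Rinv_0_lt_compat, HN]).
  apply Rle_trans with (exp (u / (1 + u)) ^ m).
  - rewrite exp_mult_INR.
    replace (INR m) with (INR (S m) - 1) by (rewrite S_INR; ring).
    set (N := INR (S m)) in *.
    replace ((N - 1) * (u / (1 + u))) with (D - 1 + (N - D ^ 2) / (N + D))
      by (unfold u; field; lra).
    assert (0 <= (N - D ^ 2) / (N + D)).
    { apply Rmult_le_pos; [lra|left; apply Rinv_0_lt_compat; lra]. }
    destruct (Rle_lt_or_eq_dec 0 _ H) as [H'|H'].
    + left; apply exp_increasing; lra.
    + rewrite <- H'; right; f_equal; ring.
  - apply pow_incr; split; [left; apply exp_pos|apply exp_quotient_le; exact Hu].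
Qed.

Lemma pow_le_3 (m : nat) : (1 + 1 / INR (S m)) ^ m <= 3.
Proof.
  pose proof (lt_0_INR (S m) ltac:(lia)) as HN.
  assert (0 < 1 / INR (S m)) by (apply Rdiv_lt_0_compat; lra).
  apply Rle_trans with (exp (1 / INR (S m)) ^ m).
  - apply pow_incr; split; [lra|apply exp_ineq1_le].
  - rewrite exp_mult_INR. apply Rle_trans with (2 := exp_le_3).
    left; apply exp_increasing.
    apply Rlt_le_trans with (INR (S m) * (1 / INR (S m))); [|right; field; lra].
    apply Rmult_lt_compat_r; [lra|]. rewrite S_INR; lra.
Qed.

(** * Volumes of the body, its kernel, halves and central section; its diameter *)

Lemma nat_floor (x : R) : 0 <= x -> exists k : nat, INR k <= x < INR k + 1.
Proof.
  intros Hx. destruct (archimed x) as [H1 H2].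
  assert (Hz : (0 < up x)%Z) by (apply lt_IZR; lra).
  exists (Z.to_nat (up x - 1)). rewrite INR_IZR_INZ, Z2Nat.id, minus_IZR by lia. lra.
Qed.

(* The [j]-th box covers the points with [u - 1 <= |x_1| <= u], [u = D + 1/2 - j/2],
   on the side of the hyperplane given by the parity of [j]; the bound
   [1 + t <= exp t] makes the volumes an exactly geometric sequence. *)
Lemma bowtie_cover (m : nat) (D : R) :
  (1 <= m)%nat -> 1 <= D -> let q := INR m / INR (S m) in
  cover_sums (S m) (bowtie (S m) D)
    ((2 / INR (S m)) ^ m * exp (q * (D + 3 / 2)) / (1 - exp (- (q / 2)))).
Proof.
  intros Hm HD q. pose proof (INR_ge_1 (S m) ltac:(lia)) as HN.
  set (k := / INR (S m)). assert (Hk : 0 < k) by (apply Rinv_0_lt_compat; lra).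
  set (u := fun j => D + 1 / 2 - INR j / 2).
  set (w := fun j => k * exp ((u j + 1) * k)).
  set (t := fun j => if Nat.even j then u j - 1 else - u j).
  exists (fun j i => match i with O => t j | S _ => - w j end),
         (fun j i => match i with O => t j + 1 | S _ => w j end).
  assert (Hw : forall j, 0 < w j) by (intros j; apply Rmult_lt_0_compat; [lra|apply exp_pos]).
  split.
  - intros x Hx. destruct (bowtie_coords _ _ _ HD Hx) as [H0 H].
    assert (Hj : exists j, t j <= x 0%nat <= t j + 1 /\ Rabs (x 0%nat) <= u j).
    { revert H0; unfold Rabs; destruct Rcase_abs as [Hneg|Hpos]; intros H0.
      (* On each side the boxes step inwards by unit lengths: [u (2 * i + 1) = D - i] on the
         negative side and [u (2 * i) = D + 1 / 2 - i] on the positive one, so [i] is the integer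
         part of the distance from the starting level to [Rabs (x 0)]. *)
      - destruct (nat_floor (D + x 0%nat)) as [i Hi]; [lra|].
        exists (2 * i + 1)%nat. unfold t, u.
        rewrite Nat.even_add, Nat.even_mul, plus_INR, mult_INR; simpl. lra.
      - destruct (nat_floor (D + 1 / 2 - x 0%nat)) as [i Hi]; [lra|].
        exists (2 * i)%nat. unfold t, u.
        rewrite Nat.even_mul, mult_INR; simpl. lra. }
    destruct Hj as [j [Ht Hu]]. exists j. intros [|i] Hi; [exact Ht|].
    specialize (H (S i) ltac:(lia)).
    assert (Rabs (x (S i)) <= w j).
    { apply Rle_trans with (1 := H). apply Rmult_le_compat_l; [fold k; lra|].
      apply Rle_trans with (2 := exp_ineq1_le _). apply Rplus_le_compat_l.
      unfold Rdiv; fold k. apply Rmult_le_compat_r; lra. }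
    revert H1; unfold Rabs; destruct Rcase_abs; lra.
  - assert (Hq : 0 < q).
    { apply Rmult_lt_0_compat; [apply lt_0_INR; lia|exact Hk]. }
    assert (Hr : 0 <= exp (- (q / 2)) < 1).
    { split; [left; apply exp_pos|]. rewrite <- exp_0. apply exp_increasing; lra. }
    pose proof (infinite_sum_geometric ((2 / INR (S m)) ^ m * exp (q * (D + 3 / 2)))
      (exp (- (q / 2))) Hr) as G.
    intros eps He. destruct (G eps He) as [N0 HN0]. exists N0; intros M HM.
    specialize (HN0 M HM). rewrite (sum_eq _ (fun j =>
      (2 / INR (S m)) ^ m * exp (q * (D + 3 / 2)) * exp (- (q / 2)) ^ j)); [exact HN0|].
    (* The [j]-th volume is [(2 * k) ^ m * exp (q * (u j + 1))] with [q * (u j + 1) = q * (D + 3 /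
       2) - j * q / 2], whence the ratio [exp (- (q / 2))]. *)
    intros j _. rewrite (boxvol_first m _ _ 1 (2 * w j)).
    + rewrite exp_mult_INR, Rmult_1_l, Rmult_assoc, <- exp_plus.
      replace (2 * w j) with (2 / INR (S m) * exp ((u j + 1) * k))
        by (unfold w, Rdiv; fold k; ring).
      rewrite Rpow_mult_distr, exp_mult_INR. f_equal. f_equal.
      unfold q, u, k. field. lra.
    + lra.
    + specialize (Hw j); lra.
    + ring.
    + intros i; ring.
Qed.

Lemma vol_bowtie_le (m : nat) (D v : R) :
  (1 <= m)%nat -> 1 <= D -> is_vol (S m) (bowtie (S m) D) v ->
  v <= 5 * exp (D + 3 / 2) * (2 / INR (S m)) ^ m.
Proof.
  intros Hm HD [Hlb _]. apply Rle_trans with (1 := Hlb _ (bowtie_cover m D Hm HD)).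
  pose proof (INR_ge_1 m Hm) as HM.
  assert (Hq : 1 / 2 <= INR m / INR (S m) < 1).
  { rewrite S_INR. split; apply Rmult_le_reg_r with (INR m + 1) || apply Rmult_lt_reg_r with (INR m + 1);
    try lra; unfold Rdiv; rewrite ?Rmult_assoc, ?Rinv_l; lra. }
  set (q := INR m / INR (S m)) in *.
  set (A := (2 / INR (S m)) ^ m).
  assert (HA : 0 < A) by (apply pow_lt, Rdiv_lt_0_compat; [lra|apply lt_0_INR; lia]).
  assert (H1 : exp (q * (D + 3 / 2)) <= exp (D + 3 / 2)).
  { left; apply exp_increasing. nra. }
  (* From [1 / 2 <= q] follows [exp (q / 2) >= 5 / 4]; the geometric series thus costs a factor of
     at most 5. *)
  assert (H2 : exp (- (q / 2)) <= 4 / 5).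
  { rewrite exp_Ropp. replace (4 / 5) with (/ (5 / 4)) by field.
    apply Rinv_le_contravar; [lra|]. pose proof (exp_ineq1_le (q / 2)); lra. }
  unfold Rdiv at 1. apply Rle_trans with (A * exp (D + 3 / 2) * 5); [|right; ring].
  pose proof (exp_pos (q * (D + 3 / 2))).
  apply Rmult_le_compat.
  - apply Rmult_le_pos; lra.
  - left; apply Rinv_0_lt_compat; lra.
  - apply Rmult_le_compat_l; lra.
  - replace 5 with (/ (1 / 5)) by field. apply Rinv_le_contravar; lra.
Qed.

Lemma vol_kernel_bowtie_ge (m : nat) (D v : R) :
  1 <= D -> is_vol (S m) (kernel (bowtie (S m) D)) v ->
  2 * (2 / INR (S m)) ^ m <= v.
Proof.
  intros HD Hv.
  pose proof (inv_INR_bounds (S m) ltac:(lia)) as HI. set (k := / INR (S m)) in *.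
  set (b := fun i => match i with O => 1 | S _ => k end).
  rewrite <- (boxvol_first m (fun i => - b i) b).
  - apply boxvol_le_vol with (3 := Hv).
    + intros [|i] _; simpl; lra.
    + intros x [Hx H]. apply kernel_bowtie_core; [lia|exact HD|exact Hx| |].
      * apply (H 0%nat); lia.
      * intros [|i] Hi; [lia|]. specialize (H (S i) ltac:(lia)). simpl in H.
        fold k. apply Rabs_le; lra.
  - lra.
  - unfold Rdiv; fold k; lra.
  - simpl; lra.
  - intros i. change (k - - k = 2 * k). ring.
Qed.

(** The outermost slab [D - 1 <= s * x 0 <= D] suffices: it contains a box of length 1 and
    half-width [w], the half-width of the frustum at its inner end. The set [T] stands for either
    half or for the whole body. *)
Lemma half_bowtie_vol_ge (m : nat) (D s : R) (T : pset) (v : R) :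
  1 <= D -> D ^ 2 <= INR (S m) -> Rabs s = 1 ->
  (forall x, bowtie (S m) D x -> 0 <= s * x 0%nat -> T x) ->
  is_vol (S m) T v -> exp (D - 1) * (2 / INR (S m)) ^ m <= v.
Proof.
  intros HD Hm Hs HT Hv.
  pose proof (inv_INR_bounds (S m) ltac:(lia)) as HI. set (k := / INR (S m)) in *.
  set (w := k * (1 + D * k)).
  assert (Hw : 0 <= w) by (unfold w; apply Rmult_le_pos; nra).
  assert (Hs' : s = 1 \/ s = -1).
  { revert Hs; unfold Rabs; destruct Rcase_abs; lra. }
  set (t := if Rlt_dec s 0 then - D else D - 1).
  apply Rle_trans with (1 * (2 * w) ^ m).
  - replace (2 * w) with ((1 + D / INR (S m)) * (2 / INR (S m)))
      by (unfold w, Rdiv; fold k; ring).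
    rewrite Rpow_mult_distr, Rmult_1_l. apply Rmult_le_compat_r.
    + apply pow_le. unfold Rdiv; fold k; lra.
    + apply exp_le_pow; lra.
  - rewrite <- (boxvol_first m (fun i => match i with O => t | S _ => - w end)
                               (fun i => match i with O => t + 1 | S _ => w end)).
    + apply boxvol_le_vol with (3 := Hv).
      * intros [|i] _; lra.
      * intros x [Hx H]. pose proof (H 0%nat ltac:(lia)) as H0. cbv beta iota in H0.
        assert (Hsx : D - 1 <= s * x 0%nat <= D).
        { revert H0; unfold t; destruct Rlt_dec; intros; destruct Hs' as [->| ->]; lra. }
        assert (Hf : frustum (S m) D s x).
        { split; [lra|]. intros [|i] Hi; [lia|]. specialize (H (S i) ltac:(lia)).
          cbv beta iota in H. apply Rle_trans with w; [apply Rabs_le; lra|].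
          unfold w, Rdiv; fold k. apply Rmult_le_compat_l; [lra|].
          apply Rplus_le_compat_l, Rmult_le_compat_r; lra. }
        apply HT; [|lra]. split; [exact Hx|].
        destruct Hs' as [->| ->]; [left|right]; exact Hf.
    + lra.
    + lra.
    + ring.
    + intros i; ring.
Qed.

(** At [x 0 = 0] both pieces have half-width [k * (1 + k)], and [(1 + k) ^ m] is at most 3. *)
Lemma vol_hslice_bowtie_le (m : nat) (D v : R) :
  (1 <= m)%nat -> 1 <= D -> is_vol m (hslice (S m) (bowtie (S m) D)) v ->
  v <= 3 * (2 / INR (S m)) ^ m.
Proof.
  intros Hm HD Hv.
  pose proof (inv_INR_bounds (S m) ltac:(lia)) as HI. set (k := / INR (S m)) in *.
  set (w := k * (1 + 1 * k)).
  apply Rle_trans with (boxvol m (fun _ => - w) (fun _ => w)).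
  - apply vol_le_boxvol with (3 := Hv); [exact Hm|].
    intros x [_ Hx] i Hi. destruct (bowtie_coords _ _ _ HD Hx) as [_ H].
    specialize (H (S i) ltac:(lia)). simpl shift0 in H. rewrite Rabs_R0, Rplus_0_l in H.
    unfold Rdiv in H; fold k w in H.
    revert H; unfold Rabs; destruct Rcase_abs; lra.
  - unfold boxvol. rewrite prodR_const, Rmax_right by (unfold w; nra).
    replace (w - - w) with ((1 + 1 / INR (S m)) * (2 / INR (S m)))
      by (unfold w, Rdiv; fold k; ring).
    rewrite Rpow_mult_distr. apply Rmult_le_compat_r; [|apply pow_le_3].
    apply pow_le. unfold Rdiv; fold k; lra.
Qed.

(** A unit segment on the first axis gives the positivity of [d], which allows division by it. *)
Lemma diam_bowtie (n : nat) (D d : R) :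
  (1 <= n)%nat -> 1 <= D -> is_diam n (bowtie n D) d -> 0 < d <= 7 * D.
Proof.
  intros Hn HD [Hub Hlub]. pose proof (inv_INR_bounds n Hn). split.
  - set (p := fun z i => match i with O => z | S _ => 0 : R end).
    assert (Hp : forall z, -1 <= z <= 1 -> bowtie n D (p z)).
    { intros z Hz. apply kernel_bowtie_core; [exact Hn|exact HD| |exact Hz|].
      - intros [|i] Hi; [lia|reflexivity].
      - intros [|i] Hi; [lia|]. simpl. rewrite Rabs_R0; lra. }
    apply Rlt_le_trans with (dist n (p 1) (p 0)).
    + apply Rlt_le_trans with (2 := dist_coord n 0 (p 1) (p 0) ltac:(lia)).
      simpl. rewrite Rminus_0_r, Rabs_R1; lra.
    + apply Hub; exists (p 1), (p 0); split; [|split; [|reflexivity]]; apply Hp; lra.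
  - apply Hlub; intros r [x [y [Hx [Hy ->]]]]. apply bowtie_dist_le; assumption.
Qed.

Theorem theorem3p1 :
  exists C c : R, 0 < C /\ 0 < c /\
  forall eta : R, 0 < eta < 1 ->
  exists (Sq : nat -> pset) (N : nat),
    (forall n, (1 <= n)%nat ->
       subRn n (Sq n) /\ star_body n (Sq n) /\ centrally_symmetric (Sq n)) /\
    (forall n, (1 <= n)%nat -> (N <= n)%nat ->
       (forall vK vS, is_vol n (kernel (Sq n)) vK -> is_vol n (Sq n) vS ->
          c * eta <= vK / vS) /\
       (forall vH vm vp d,
          is_vol (n - 1) (hslice n (Sq n)) vH ->
          is_vol n (Hminus (Sq n)) vm ->
          is_vol n (Hplus (Sq n)) vp ->
          is_diam n (Sq n) d ->
          vH <= C * (eta * ln (1 / eta) / ((1 - eta) * d)) * Rmin vm vp)).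
Proof.
  (* [42 = 3 * 7 * 2]: the section bound, the diameter bound, and [(1 - eta) * D <= 2 * l]. The
     second constant divides the kernel bound [2 * A] by the body bound [5 * exp (l + 5 / 2) * A],
     where [exp l = / eta]. *)
  exists 42, (2 / (5 * exp (5 / 2))).
  pose proof (exp_pos (5 / 2)) as He.
  split; [lra|split; [apply Rdiv_lt_0_compat; lra|]].
  intros eta Heta. set (l := ln (1 / eta)).
  assert (Hel : exp l = / eta).
  { unfold l. rewrite exp_ln; [unfold Rdiv; ring|apply Rdiv_lt_0_compat; lra]. }
  assert (Hl : 1 - eta <= l).
  { pose proof (exp_ineq1_le (- l)) as H. rewrite exp_Ropp, Hel, Rinv_inv in H. lra. }
  set (D := 1 + l). assert (HD : 1 <= D) by (unfold D; lra).
  (* [N] makes [D ^ 2 <= n], as the volume bound for the halves requires; the maximum with 2 ensures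
     [1 <= m] for [n = S m]. *)
  destruct (INR_unbounded (D ^ 2)) as [N HN].
  exists (fun n => bowtie n D), (Nat.max 2 N). split.
  { intros n Hn; split; [intros x Hx; exact (proj1 Hx)|split].
    - apply bowtie_star_body; assumption.
    - apply bowtie_symmetric. }
  intros n _ Hn. destruct n as [|m]; [lia|].
  assert (HDm : D ^ 2 <= INR (S m)).
  { apply Rle_trans with (INR N); [lra|apply le_INR; lia]. }
  set (A := (2 / INR (S m)) ^ m).
  assert (HA : 0 < A) by (apply pow_lt, Rdiv_lt_0_compat; [lra|apply lt_0_INR; lia]).
  assert (Hhalf : forall s T v, Rabs s = 1 ->
    (forall x, bowtie (S m) D x -> 0 <= s * x 0%nat -> T x) ->
    is_vol (S m) T v -> / eta * A <= v).
  { intros s T v Hs HT Hv. rewrite <- Hel. replace l with (D - 1) by (unfold D; ring).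
    exact (half_bowtie_vol_ge m D s T v HD HDm Hs HT Hv). }
  assert (Heta' : 0 < / eta) by (apply Rinv_0_lt_compat; lra).
  split.
  - intros vK vS HK HS.
    pose proof (vol_kernel_bowtie_ge m D vK HD HK) as BK.
    pose proof (vol_bowtie_le m D vS ltac:(lia) HD HS) as BS.
    (* Applied to the whole body, the lower bound yields [0 < vS]. *)
    pose proof (Hhalf 1 _ vS Rabs_R1 (fun x Hx _ => Hx) HS) as BS0.
    fold A in BK, BS.
    replace (D + 3 / 2) with (l + 5 / 2) in BS by (unfold D; field).
    rewrite exp_plus, Hel in BS.
    assert (HvS : 0 < vS) by nra.
    apply Rmult_le_reg_r with vS; [exact HvS|].
    replace (vK / vS * vS) with vK by (field; lra).
    apply Rle_trans with (2 * A); [|exact BK].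
    apply Rle_trans with (2 / (5 * exp (5 / 2)) * eta * (5 * (/ eta * exp (5 / 2)) * A)).
    + apply Rmult_le_compat_l; [|exact BS].
      apply Rmult_le_pos; [left; apply Rdiv_lt_0_compat; lra|lra].
    + right; field; lra.
  - intros vH vm vp d HH Hm Hp Hd.
    replace (S m - 1)%nat with m in HH by lia.
    pose proof (vol_hslice_bowtie_le m D vH ltac:(lia) HD HH) as BH. fold A in BH.
    destruct (diam_bowtie (S m) D d ltac:(lia) HD Hd) as [Hd0 Hd7].
    assert (Bm : / eta * A <= vm).
    { apply (Hhalf (-1) (Hminus (bowtie (S m) D))); [rewrite Rabs_left; lra| |exact Hm].
      intros x Hx H0; split; [exact Hx|lra]. }
    assert (Bp : / eta * A <= vp).
    { apply (Hhalf 1 (Hplus (bowtie (S m) D))); [apply Rabs_R1| |exact Hp].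
      intros x Hx H0; split; [exact Hx|lra]. }
    apply Rle_trans with (1 := BH).
    (* Each half has volume at least [/ eta * A], so [eta] cancels and [3 * (1 - eta) * d <= 42 * l]
       remains. *)
    apply Rle_trans with (42 * (eta * l / ((1 - eta) * d)) * (/ eta * A)).
    + replace (42 * (eta * l / ((1 - eta) * d)) * (/ eta * A))
        with (42 * l / ((1 - eta) * d) * A) by (field; lra).
      apply Rmult_le_compat_r; [lra|].
      apply Rmult_le_reg_r with ((1 - eta) * d); [nra|].
      replace (42 * l / ((1 - eta) * d) * ((1 - eta) * d)) with (42 * l) by (field; lra).
      (* Since [1 - eta <= l], also [(1 - eta) * D <= 2 * l]. *)
      assert ((1 - eta) * d <= (1 - eta) * (7 * D)) by (apply Rmult_le_compat_l; lra).
      unfold D in *. nra.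
    + apply Rmult_le_compat_l; [|apply Rmin_glb; assumption].
      apply Rmult_le_pos; [lra|]. apply Rmult_le_pos; [nra|].
      left; apply Rinv_0_lt_compat; nra.
Qed.
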